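(* Let $n\ge 1$, $k\ge 0$ and $m=2n+k$. There is a continuous map $f\colon \mathbb{S}(W_{n,k})\to |\operatorname{Hom}(K_2,SG_{n,k})|$ which is equivariant with respect to the actions of $C_2$ and of $D_{2m}$, i.e. $f(-x)=\tau\cdot f(x)$ and $f(x\cdot\gamma)=f(x)\cdot\gamma$ for all $x\in\mathbb{S}(W_{n,k})$ and $\gamma\in D_{2m}$.
   Context: A graph $G$ consists of a vertex set $V(G)$ and a symmetric relation $E(G)\subseteq V(G)\times V(G)$ (adjacency). For $n\ge1$, $k\ge0$, $m=2n+k$, the stable Kneser graph $SG_{n,k}$ has as vertices the $n$-element subsets $S\subseteq\mathbb{Z}_m$ that contain no pair $\{i,i+1\}$ (indices mod $m$); two vertices are adjacent iff they are disjoint. $K_2$ is the complete graph on vertices $\{0,1\}$. For graphs $G,H$, $\operatorname{Hom}(G,H)$ is the poset of functions $f$ from $V(G)$ to the nonempty subsets of $V(H)$ such that $f(u)\times f(v)\subseteq E(H)$ for all $(u,v)\in E(G)$, ordered by pointwise inclusion; $|\operatorname{Hom}(G,H)|$ is the geometric realization of its order complex. The dihedral group $D_{2m}=\langle\sigma,\rho\mid \rho^2=\sigma^m=(\sigma\rho)^2=1\rangle$ acts from the right on $SG_{n,k}$ by $S\cdot\sigma=\{j+1:j\in S\}$, $S\cdot\rho=\{-j:j\in S\}$ (mod $m$), and hence from the right on $\operatorname{Hom}(K_2,SG_{n,k})$; the group $C_2=\langle\tau\rangle$ acts on $K_2$ by swapping $0,1$, inducing a commuting left action on $\operatorname{Hom}(K_2,SG_{n,k})$.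 $W_{n,k}$ is $\mathbb{R}^{k+1}$ with the following orthogonal right $D_{2m}$-action, where $R_\phi=\begin{pmatrix}\cos\phi&-\sin\phi\\ \sin\phi&\cos\phi\end{pmatrix}$: if $k=2r$, $x\cdot\sigma=-\operatorname{diag}(1,R_{2\pi/m},R_{4\pi/m},\dots,R_{k\pi/m})x$ and $x\cdot\rho=\operatorname{diag}(1,1,-1,1,-1,\dots,1,-1)x$; if $k=2r+1$, $x\cdot\sigma=-\operatorname{diag}(R_{\pi/m},R_{3\pi/m},\dots,R_{k\pi/m})x$ and $x\cdot\rho=\operatorname{diag}(1,-1,1,-1,\dots,1,-1)x$. $\mathbb{S}(W_{n,k})$ is its unit sphere, on which $\tau$ acts antipodally, $\tau\cdot x=-x$. *)

(* Defs.v *)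
From HB Require Import structures.
From mathcomp Require Import all_boot all_order all_algebra.
From mathcomp Require Import all_fingroup all_solvable.
From mathcomp Require Import all_classical all_reals all_analysis.
From mathcomp Require Import ring lra zify.
(* [set0], [set1], ... denote finite sets, not classical ones. *)
From mathcomp Require Import finset.

Set Implicit Arguments.
Unset Strict Implicit.
Unset Printing Implicit Defensive.

Import Order.TTheory GRing.Theory Num.Theory.
Import numFieldNormedType.Exports.

Local Open Scope ring_scope.

(* Loops are allowed: [adj] is only required to be symmetric. *)
Record graph := Graph {
  vertex :> finType;
  adj : rel vertex;
  adj_sym : symmetric adj }.

Definition K2_adj : rel bool := fun u v => u != v.

Lemma K2_adj_sym : symmetric K2_adj.
Proof. by move=> u v; rewrite /K2_adj eq_sym. Qed.

(* The vertices 0 and 1 are [false] and [true]. *)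
Definition K2 : graph := Graph K2_adj_sym.

Definition is_multihom (G H : graph) (f : {ffun G -> {set H}}) : bool :=
  [forall u, f u != set0] &&
  [forall u, forall v, @adj G u v ==>
     [forall x in f u, forall y in f v, @adj H x y]].

Record HomPoset (G H : graph) := MultiHom {
  multihom :> {ffun G -> {set H}};
  multihomP : is_multihom multihom }.

HB.instance Definition _ (G H : graph) := [isSub for @multihom G H].
HB.instance Definition _ (G H : graph) := [Finite of HomPoset G H by <:].

Definition le_Hom (G H : graph) (f g : HomPoset G H) : bool :=
  [forall u, f u \subset g u].

Lemma le_Hom_refl G H : reflexive (@le_Hom G H).
Proof. by move=> f; apply/forallP. Qed.

Lemma le_Hom_anti G H : antisymmetric (@le_Hom G H).
Proof.
move=> f g /andP[/forallP fg /forallP gf]; apply/val_inj/ffunP => u /=.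
by apply/eqP; rewrite eqEsubset fg gf.
Qed.

Lemma le_Hom_trans G H : transitive (@le_Hom G H).
Proof.
move=> g f h /forallP fg /forallP gh; apply/forallP => u.
exact: fintype.subset_trans (fg u) (gh u).
Qed.

Fact Hom_display : Order.disp_t. Proof. exact: Order.Disp tt tt. Qed.

HB.instance Definition _ (G H : graph) :=
  Order.Le_isPOrder.Build Hom_display (HomPoset G H)
    (@le_Hom_refl G H) (@le_Hom_anti G H) (@le_Hom_trans G H).

Lemma le_HomE G H (f g : HomPoset G H) :
  (f <= g)%O = [forall u, f u \subset g u].
Proof. by []. Qed.

Definition graph_hom (G H : graph) (phi : G -> H) : Prop :=
  forall u v, @adj G u v -> @adj H (phi u) (phi v).

Lemma multihom_pre (G G' H : graph) (phi : G' -> G)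
    (phi_adj : graph_hom phi) (f : HomPoset G H) :
  is_multihom [ffun u => f (phi u)].
Proof.
case: f => f /= /andP[/forallP f0 /forallP fP]; apply/andP; split.
  by apply/forallP => u; rewrite ffunE.
apply/forallP => u; apply/forallP => v; apply/implyP => uv; rewrite !ffunE.
by have /forallP/(_ (phi v))/implyP := fP (phi u); apply; apply: phi_adj.
Qed.

Definition Hom_pre (G G' H : graph) (phi : G' -> G)
    (phi_adj : graph_hom phi) (f : HomPoset G H) :
  HomPoset G' H := MultiHom (multihom_pre phi_adj f).

Lemma Hom_pre_homo (G G' H : graph) (phi : G' -> G)
    (phi_adj : graph_hom phi) :
  {homo @Hom_pre G G' H phi phi_adj : f g / (f <= g)%O}.
Proof.
move=> f g; rewrite !le_HomE => /forallP fg; apply/forallP => u.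
by rewrite /= !ffunE.
Qed.

Lemma multihom_post (G H H' : graph) (psi : H -> H')
    (psi_adj : graph_hom psi) (f : HomPoset G H) :
  is_multihom [ffun u => psi @: f u].
Proof.
case: f => f /= /andP[/forallP f0 /forallP fP]; apply/andP; split.
  apply/forallP => u; rewrite ffunE; have /set0Pn[x fx] := f0 u.
  by apply/set0Pn; exists (psi x); apply: imset_f.
apply/forallP => u; apply/forallP => v; apply/implyP => uv; rewrite !ffunE.
have /forallP/(_ v)/implyP/(_ uv)/forall_inP fuv := fP u.
apply/forall_inP => _ /imsetP[x fx ->]; apply/forall_inP => _ /imsetP[y fy ->].
by apply: psi_adj; have /forall_inP := fuv x fx; apply.
Qed.

Definition Hom_post (G H H' : graph) (psi : H -> H')
    (psi_adj : graph_hom psi) (f : HomPoset G H) :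
  HomPoset G H' := MultiHom (multihom_post psi_adj f).

Lemma Hom_post_homo (G H H' : graph) (psi : H -> H')
    (psi_adj : graph_hom psi) :
  {homo @Hom_post G H H' psi psi_adj : f g / (f <= g)%O}.
Proof.
move=> f g; rewrite !le_HomE => /forallP fg; apply/forallP => u.
by rewrite /= !ffunE; apply: imsetS.
Qed.

Definition order_complex d (P : finPOrderType d) : {set {set P}} :=
  [set A : {set P} | (A != set0) &&
     [forall x in A, forall y in A, (x >=< y)%O]].

(* Barycentric coordinates: as there are finitely many vertices, the topology
   of the realization is the one induced by the product topology. *)
Definition geom_realization (R : realType) (V : finType) (K : {set {set V}}) :
    set {ptws V -> R} :=
  [set t : {ptws V -> R} | [/\ forall v, 0 <= t v, \sum_v t v = 1
     & [set v | t v != 0]%SET \in K]]%classic.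
Arguments geom_realization R {V} K.

Definition realization (R : realType) d (P : finPOrderType d) :
    topologicalType :=
  classical_sets.set_type (geom_realization R (order_complex P)).

Definition push_coord (R : realType) (V V' : finType) (phi : V -> V')
    (t : {ptws V -> R}) : {ptws V' -> R} :=
  fun w => \sum_(v | phi v == w) t v.

Lemma push_coord_mem (R : realType) d (P : finPOrderType d)
    d' (Q : finPOrderType d') (phi : P -> Q)
    (phi_homo : {homo phi : x y / (x <= y)%O}) (t : realization R P) :
  push_coord phi (\val t) \in geom_realization R (order_complex Q).
Proof.
case: t => t /= /set_mem[t0 t1]; rewrite inE => /andP[_ /forall_inP tK].
have p0 w : 0 <= push_coord phi t w by apply: sumr_ge0.
have p1 : \sum_w push_coord phi t w = 1.
  by rewrite -[RHS]t1 [RHS](partition_big phi xpredT).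
apply/mem_set; split=> //; rewrite inE; apply/andP; split.
  apply/set0Pn; apply/existsP; apply: contraPT p1 => /existsPn p_eq0.
  rewrite big1 ?(eq_sym 0) => [|w _]; first by apply/eqP; rewrite eq_sym oner_neq0.
  by have := p_eq0 w; rewrite inE negbK => /eqP.
have supp w : push_coord phi t w != 0 -> exists2 v, t v != 0 & phi v = w.
  move=> /eqP pw; apply: contrapT => nv; apply: pw.
  rewrite /push_coord big1 // => v /eqP vw; apply/eqP/negPn/negP => tv.
  by apply: nv; exists v.
apply/forall_inP => x; rewrite inE => /supp[v tv <-].
apply/forall_inP => y; rewrite inE => /supp[w tw <-].
have /forall_inP/(_ w) : [forall z in [set v | t v != 0]%SET, (v >=< z)%O].
  by apply: tK; rewrite inE.
rewrite inE => /(_ tw) /orP[] le; apply/orP; [left|right]; exact: phi_homo.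
Qed.

Definition realization_map (R : realType) d (P : finPOrderType d)
    d' (Q : finPOrderType d') (phi : P -> Q)
    (phi_homo : {homo phi : x y / (x <= y)%O}) (t : realization R P) :
  realization R Q :=
  exist (fun u => u \in geom_realization R (order_complex Q)) _
    (push_coord_mem phi_homo t).

(* [(i, e)] stands for [sigma ^+ i * rho ^+ e]; the order is [2 * m] as soon
   as [1 < m] (note that 'Z_m is only meaningful in this case). *)
Definition dihedral (m : nat) : Type := ('Z_m * bool)%type.

HB.instance Definition _ (m : nat) := Finite.on (dihedral m).

Definition dih_mul m (g h : dihedral m) : dihedral m :=
  (if g.2 then g.1 - h.1 else g.1 + h.1, g.2 (+) h.2).

Definition dih_one m : dihedral m := (0, false).

Definition dih_inv m (g : dihedral m) : dihedral m :=
  (if g.2 then g.1 else - g.1, g.2).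

Lemma dih_mulA m : associative (@dih_mul m).
Proof.
move=> [i [|]] [j [|]] [l e]; rewrite /dih_mul /=.
all: by rewrite ?negbK ?opprD ?opprK ?addrA.
Qed.

Lemma dih_mul1 m : left_id (@dih_one m) (@dih_mul m).
Proof. by move=> [i e]; rewrite /dih_mul /= add0r. Qed.

Lemma dih_mulV m : left_inverse (@dih_one m) (@dih_inv m) (@dih_mul m).
Proof.
by move=> [i [|]]; rewrite /dih_mul /dih_one /= ?addbb ?subrr ?addNr.
Qed.

HB.instance Definition _ (m : nat) :=
  Finite_isGroup.Build (dihedral m) (@dih_mulA m) (@dih_mul1 m) (@dih_mulV m).

Definition dih_sigma m : dihedral m := (1, false).
Definition dih_rho m : dihedral m := (0, true).

Lemma dih_mulE m (g h : dihedral m) : (g * h)%g = dih_mul g h.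
Proof. by []. Qed.

Lemma card_dih m : (1 < m)%N -> #|{: dihedral m}| = (2 * m)%N.
Proof. by move=> m1; rewrite card_prod card_bool card_ord Zp_cast // mulnC. Qed.

Lemma dih_sigmaX m i : (dih_sigma m ^+ i)%g = (i%:R, false).
Proof.
elim: i => [//|i IHi]; rewrite expgS IHi dih_mulE /dih_mul /=.
by rewrite -mulrS.
Qed.

Lemma dihE m (g : dihedral m) :
  g = (dih_sigma m ^+ (g.1 : nat) * dih_rho m ^+ (g.2 : nat))%g.
Proof.
case: g => i e /=; rewrite dih_sigmaX natr_Zp.
by case: e; rewrite ?mulg1 // dih_mulE /dih_mul /= addr0.
Qed.

Lemma dih_presentation m : (1 < m)%N ->
  [/\ dih_rho m ^+ 2 = 1, dih_sigma m ^+ m = 1,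
      (dih_sigma m * dih_rho m) ^+ 2 = 1 &
      <[dih_sigma m]> <*> <[dih_rho m]> = [set: dihedral m]]%g.
Proof.
move=> m1; split.
- by rewrite expgS dih_mulE /dih_mul /= subr0.
- by rewrite dih_sigmaX pchar_Zp.
- by rewrite expgS expg1 !dih_mulE /dih_mul /= addr0 subrr.
- apply/setP => g; rewrite inE [g]dihE groupM // groupX // mem_gen // inE cycle_id ?orbT //.
Qed.

Lemma dih_isog m : (1 < m)%N -> [set: dihedral m] \isog [set: dihedral_gtype m.*2].
Proof.
move=> m1; rewrite isogEcard card_dihedral // cardsT card_dih // mul2n leqnn andbT.
rewrite Grp_dihedral //; apply/existsP; exists (dih_sigma m, dih_rho m) => /=.
have [r2 sm sr gen] := dih_presentation m1.
by rewrite !xpair_eqE /= gen sm !addr0 !subr0 sub0r !eqxx.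
Qed.

(* [act1] and [actM] are only available for actions on finite types. *)
Lemma total_actM (gT : finGroupType) T (to : {action gT &-> T}) x a b :
  to x (a * b)%g = to (to x a) b.
Proof. by case: to => f [_ fM] /=; apply: fM; rewrite inE. Qed.

Lemma total_act1 (gT : finGroupType) T (to : {action gT &-> T}) x :
  to x 1%g = x.
Proof.
have : to (to x 1%g) 1%g = to x 1%g by rewrite -total_actM mulg1.
by case: to => f [f_inj _] /= /f_inj.
Qed.

Definition dih_fun m T (s r : T -> T) (x : T) (g : dihedral m) : T :=
  iter g.2 r (iter g.1 s x).

Section DihFun.
Variables (m : nat) (m_gt1 : (1 < m)%N) (T : Type) (s r : T -> T).
Hypotheses (sm : forall x, iter m s x = x) (r2 : forall x, r (r x) = x).
Hypothesis (sr2 : forall x, r (s (r (s x))) = x).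

Let iter_modn a x : iter (a %% m) s x = iter a s x.
Proof.
rewrite [in RHS](divn_eq a m) addnC iterD; congr (iter _ _ _).
by elim: (a %/ m)%N => [//|b]; rewrite mulSn iterD sm.
Qed.

Let iterZD (i j : 'Z_m) x : iter (i + j)%R s x = iter j s (iter i s x).
Proof.
have -> : ((i + j)%R : nat) = ((i + j) %% m)%N.
  by rewrite /=; congr (_ %% _)%N; exact: Zp_cast.
by rewrite iter_modn addnC iterD.
Qed.

Let iter_r (i : 'Z_m) x : iter (- i)%R s (r x) = r (iter i s x).
Proof.
have sK a y : iter a s (r (iter a s y)) = r y.
  elim: a y => [//|a IHa] y; rewrite iterSr iterS.
  have -> : s (r (s (iter a s y))) = r (iter a s y) by rewrite -[LHS]r2 sr2.
  exact: IHa.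
rewrite -(sK i x) -iterZD addrC.
by rewrite addNr.
Qed.

Lemma dih_fun_action : is_action [set: dihedral m] (@dih_fun m T s r).
Proof.
apply: is_total_action => [x|x [i e] [j f]]; first by [].
case: e; last by rewrite -[RHS]/(iter f r _) -iterZD.
rewrite -[LHS]/(iter (~~ f) r (iter (i - j)%R s x)) iterZD.
rewrite -[RHS]/(iter f r (iter j s (r (iter i s x)))).
have := iter_r (- j) (iter i s x); rewrite opprK => ->.
by case: f => //=; rewrite r2.
Qed.
End DihFun.

Definition dih_action m (m_gt1 : (1 < m)%N) T (s r : T -> T)
    (sm : forall x, iter m s x = x) (r2 : forall x, r (r x) = x)
    (sr2 : forall x, r (s (r (s x))) = x) : {action dihedral m &-> T} :=
  Action (dih_fun_action m_gt1 sm r2 sr2).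

Lemma dih_actionE m m_gt1 T s r sm r2 sr2 x :
  (@dih_action m m_gt1 T s r sm r2 sr2 x (dih_sigma m) = s x) *
  (@dih_action m m_gt1 T s r sm r2 sr2 x (dih_rho m) = r x).
Proof. by [].
Qed.

Lemma multihom_eq G H (f g : HomPoset G H) : (forall u, f u = g u) -> f = g.
Proof. by move=> fg; apply/val_inj/ffunP => u; apply: fg. Qed.

Definition Hom_fun (gT : finGroupType) (G H : graph)
    (to : {action gT &-> H}) (to_adj : forall g, graph_hom (to^~ g))
    (f : HomPoset G H) (g : gT) : HomPoset G H := Hom_post (to_adj g) f.

Lemma Hom_fun_action (gT : finGroupType) (G H : graph)
    (to : {action gT &-> H}) (to_adj : forall g, graph_hom (to^~ g)) :
  is_action [set: gT] (@Hom_fun gT G H to to_adj).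
Proof.
apply: is_total_action => [f|f g h]; apply: multihom_eq => u /=; rewrite !ffunE.
  by rewrite (eq_imset _ (act1 to)) imset_id.
by rewrite -imset_comp; apply: eq_imset => x /=; rewrite actM.
Qed.

Definition Hom_action (gT : finGroupType) (G H : graph)
    (to : {action gT &-> H}) (to_adj : forall g, graph_hom (to^~ g)) :
  {action gT &-> HomPoset G H} := Action (@Hom_fun_action gT G H to to_adj).

Definition realization_fun (R : realType) (gT : finGroupType)
    d (P : finPOrderType d) (to : {action gT &-> P})
    (to_homo : forall g, {homo to^~ g : x y / (x <= y)%O})
    (t : realization R P) (g : gT) : realization R P :=
  realization_map (to_homo g) t.

Lemma realization_fun_action (R : realType) (gT : finGroupType)
    d (P : finPOrderType d) (to : {action gT &-> P})
    (to_homo : forall g, {homo to^~ g : x y / (x <= y)%O}) :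
  is_action [set: gT] (@realization_fun R gT d P to to_homo).
Proof.
apply: is_total_action => [t|t g h]; apply: val_inj; apply/funext => p /=.
  rewrite /push_coord (eq_bigl (pred1 p)) ?big_pred1_eq // => v.
  by rewrite /= act1.
rewrite /push_coord [RHS](eq_bigr _ (fun w _ => erefl)) /=.
rewrite (partition_big (to^~ g) (fun w => to w h == p)) /= => [|v]; last first.
  by rewrite actM.
apply: eq_bigr => w /eqP wp; apply: eq_bigl => v.
by case: (eqVneq (to v g) w) => [vw|]; rewrite ?andbF // actM vw wp eqxx.
Qed.

Definition realization_action (R : realType) (gT : finGroupType)
    d (P : finPOrderType d) (to : {action gT &-> P})
    (to_homo : forall g, {homo to^~ g : x y / (x <= y)%O}) :
  {action gT &-> realization R P} :=
  Action (realization_fun_action R to_homo).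

Definition stable (n k : nat) (S : {set 'Z_(2 * n + k)}) : bool :=
  (#|S| == n) && [forall i, ~~ ((i \in S) && (i + 1 \in S))].

Record SG_vertex (n k : nat) := SGVertex {
  SG_set :> {set 'Z_(2 * n + k)};
  SG_setP : stable SG_set }.

HB.instance Definition _ n k := [isSub for @SG_set n k].
HB.instance Definition _ n k := [Finite of SG_vertex n k by <:].

Definition SG_adj n k : rel (SG_vertex n k) := fun S T => [disjoint S & T].

Lemma SG_adj_sym n k : symmetric (@SG_adj n k).
Proof. by move=> S T; rewrite /SG_adj fintype.disjoint_sym. Qed.

Definition SG (n k : nat) : graph := Graph (@SG_adj_sym n k).

Lemma stable_rotate n k (S : SG n k) : stable [set j + 1 | j in S].
Proof.
case: S => S /= /andP[cS /forallP S1]; apply/andP; split.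
  by rewrite card_imset //; apply: addIr.
apply/forallP => i; apply: contra (S1 (i - 1)) => /andP[].
have mem1 x : (x \in [set j + 1 | j in S]) = (x - 1 \in S).
  by rewrite -[x in LHS](subrK 1) (mem_imset _ _ (@addIr _ 1)).
by rewrite !mem1 addrK subrK => -> ->.
Qed.

Definition SG_rotate n k (S : SG n k) : SG n k := SGVertex (stable_rotate S).

Lemma stable_reflect n k (S : SG n k) : stable [set - j | j in S].
Proof.
case: S => S /= /andP[cS /forallP S1]; apply/andP; split.
  by rewrite card_imset //; apply: oppr_inj.
apply/forallP => i; apply: contra (S1 (- (i + 1))) => /andP[].
have memN x : (x \in [set - j | j in S]) = (- x \in S).
  by rewrite -[x in LHS]opprK (mem_imset _ _ oppr_inj).
by rewrite !memN => iS i1S; rewrite i1S opprD subrK.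
Qed.

Definition SG_reflect n k (S : SG n k) : SG n k := SGVertex (stable_reflect S).

Lemma Zm_gt1 n k : (0 < n)%N -> (1 < 2 * n + k)%N.
Proof. by lia. Qed.

Lemma SGP n k (S T : SG n k) : S = T :> {set _} -> S = T.
Proof. exact: val_inj. Qed.

Lemma SG_rotate_order n k (S : SG n k) : (0 < n)%N ->
  iter (2 * n + k) (@SG_rotate n k) S = S.
Proof.
move=> n0; apply: SGP.
have E a : iter a (@SG_rotate n k) S = [set j + a%:R | j in (S : {set _})] :> {set _}.
  elim: a => [|a IHa].
    by rewrite (eq_imset _ (fun j => addr0 j)) imset_id.
  rewrite iterS /= IHa -imset_comp; apply: eq_imset => j /=.
  by rewrite -addrA natr1.
rewrite E (eq_imset (g := id)) ?imset_id // => j.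
by rewrite pchar_Zp ?addr0 //; apply: Zm_gt1.
Qed.

Lemma SG_reflectK n k (S : SG n k) : SG_reflect (SG_reflect S) = S.
Proof.
apply: SGP; rewrite /= -imset_comp (eq_imset (g := id)) ?imset_id // => j /=.
exact: opprK.
Qed.

Lemma SG_rotate_reflect n k (S : SG n k) :
  SG_reflect (SG_rotate (SG_reflect (SG_rotate S))) = S.
Proof.
apply: SGP; rewrite /= -!imset_comp (eq_imset (g := id)) ?imset_id // => j /=.
by rewrite opprD opprK addrK.
Qed.

Definition SG_action n k (n_gt0 : (0 < n)%N) :
    {action dihedral (2 * n + k) &-> SG n k} :=
  dih_action (Zm_gt1 k n_gt0) (fun S => SG_rotate_order S n_gt0)
    (@SG_reflectK n k) (@SG_rotate_reflect n k).

Lemma SG_action_adj n k (n_gt0 : (0 < n)%N) g :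
  graph_hom ((SG_action k n_gt0)^~ g).
Proof.
have imset_dis (phi : 'Z_(2 * n + k) -> 'Z_(2 * n + k)) (A B : {set _}) :
    injective phi -> [disjoint A & B] -> [disjoint phi @: A & phi @: B].
  by move=> phi_inj; rewrite -!setI_eq0 -imsetI => [/eqP->|? ? _ _ /phi_inj//]; rewrite imset0.
move=> S T ST; case: g => i e.
rewrite -[adj _ _]/(adj (iter e (@SG_reflect n k) (iter i (@SG_rotate n k) S))
  (iter e (@SG_reflect n k) (iter i (@SG_rotate n k) T))).
have {ST} : adj (iter i (@SG_rotate n k) S) (iter i (@SG_rotate n k) T).
  elim: (i : nat) => [//|a IHa]; apply: imset_dis IHa; exact: addIr.
by case: e => //=; apply: imset_dis; apply: oppr_inj.
Qed.

Definition Hom_SG_action n k (n_gt0 : (0 < n)%N) :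
    {action dihedral (2 * n + k) &-> HomPoset K2 (SG n k)} :=
  Hom_action K2 (SG_action_adj (k := k) n_gt0).

Lemma Hom_SG_action_homo n k (n_gt0 : (0 < n)%N) g :
  {homo (Hom_SG_action k n_gt0)^~ g : x y / (x <= y)%O}.
Proof. exact: Hom_post_homo. Qed.

Definition RHom_SG_action (R : realType) n k (n_gt0 : (0 < n)%N) :
    {action dihedral (2 * n + k) &-> realization R (HomPoset K2 (SG n k))} :=
  realization_action R (Hom_SG_action_homo (k := k) n_gt0).

Definition K2_swap : K2 -> K2 := negb.

Lemma K2_swap_adj : graph_hom K2_swap.
Proof. by case; case. Qed.

Definition RHom_tau (R : realType) (H : graph) :
    realization R (HomPoset K2 H) -> realization R (HomPoset K2 H) :=
  realization_map (@Hom_pre_homo _ _ H _ K2_swap_adj).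

Definition rot_mx (R : realType) (phi : R) : 'M[R]_2 :=
  \matrix_(a, b) if a == b then cos phi
                 else if (a < b)%N then - sin phi else sin phi.

(* The coordinates of R^(k+1) are grouped into consecutive pairs, except that
   for even [k] the coordinate 0 is alone: it is considered as the second
   element of a pair whose first element is missing. *)
Definition W_pos k (i : 'I_k.+1) : nat := i + ~~ odd k.
Definition W_block k (i : 'I_k.+1) : nat := (W_pos i)./2.
Definition W_slot k (i : 'I_k.+1) : 'I_2 := inord (odd (W_pos i)).

Definition rot_blocks (R : realType) k (theta : nat -> R) : 'M[R]_k.+1 :=
  \matrix_(i, j) if W_block i == W_block j
                 then rot_mx (theta (W_block i)) (W_slot i) (W_slot j) else 0.

(* For even [k] the block 0 is the isolated coordinate 0, on which the angle 0
   gives the 1 x 1 identity matrix. *)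
Definition W_angle (R : realType) (n k q : nat) : R :=
  (2 * q + odd k)%:R * pi / (2 * n + k)%:R.

Definition W_sigma (R : realType) (n k : nat) : 'M[R]_k.+1 :=
  - rot_blocks k (W_angle R n k).

Definition W_rho (R : realType) (k : nat) : 'M[R]_k.+1 :=
  diag_mx (\row_i if (0 < i)%N && odd (W_pos i) then -1 else 1).
Lemma rot_mxE (R : realType) (phi : R) (b c : bool) :
  rot_mx phi (inord b) (inord c) =
  if b then (if c then cos phi else sin phi)
  else if c then - sin phi else cos phi.
Proof.
rewrite mxE -val_eqE /= !inordK; by case: b; case: c.
Qed.

Lemma W_pos_inj k : injective (@W_pos k).
Proof. by move=> i j /addIn/val_inj. Qed.

Lemma W_block_slot k (i j : 'I_k.+1) :
  (i == j) = (W_block i == W_block j) && (odd (W_pos i) == odd (W_pos j)).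
Proof.
apply/eqP/andP => [->//|[/eqP bij /eqP sij]]; apply: W_pos_inj.
by rewrite -[LHS]odd_double_half -[RHS]odd_double_half sij; congr (_ + _.*2)%N.
Qed.

Lemma rot_blocksE (R : realType) k (theta : nat -> R) i j :
  rot_blocks k theta i j = if W_block i == W_block j
    then if odd (W_pos i)
         then (if odd (W_pos j) then cos (theta (W_block i)) else sin (theta (W_block i)))
         else (if odd (W_pos j) then - sin (theta (W_block i)) else cos (theta (W_block i)))
    else 0.
Proof. by rewrite mxE rot_mxE. Qed.

Lemma sum_pairs (R : realType) (F : nat -> R) N :
  \sum_(0 <= p < N.*2) F p = \sum_(0 <= q < N) (F q.*2 + F q.*2.+1).
Proof.
elim: N => [|N IHN]; first by rewrite !big_geq.
by rewrite doubleS !big_nat_recr //= IHN addrA.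
Qed.

Lemma W_pos_half k : (k.+1 + ~~ odd k)%N = ((k.+1 + ~~ odd k)./2).*2.
Proof.
rewrite -[LHS]odd_double_half oddD /=; case: (odd k) => //=.
Qed.

Lemma rot_blocksM (R : realType) k (theta theta' : nat -> R) :
  (~~ odd k -> theta 0%N = 0) ->
  rot_blocks k theta *m rot_blocks k theta' =
  rot_blocks k (fun q => theta q + theta' q).
Proof.
move=> th0; apply/matrixP => i l; rewrite mxE.
under eq_bigr do rewrite !rot_blocksE.
set b := W_block i.
pose F p : R := (if b == p./2 then
   if odd (W_pos i) then (if odd p then cos (theta b) else sin (theta b))
   else (if odd p then - sin (theta b) else cos (theta b)) else 0) *
  (if p./2 == W_block l then
    if odd p then (if odd (W_pos l) then cos (theta' p./2) else sin (theta' p./2))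
    else (if odd (W_pos l) then - sin (theta' p./2) else cos (theta' p./2))
   else 0).
have -> : \sum_(j < k.+1) F (W_pos j) =
    \sum_(0 <= p < ((k.+1 + ~~ odd k)./2).*2) F p.
  rewrite -W_pos_half.
  rewrite (@big_cat_nat _ _ _ (~~ odd k)) //= ?leq_addl //.
  have -> : \sum_(~~ odd k <= p < k.+1 + ~~ odd k) F p = \sum_(j < k.+1) F (W_pos j).
    by rewrite -[X in \sum_(X <= _ < _) _]add0n big_addn addnK big_mkord.
  rewrite [X in _ = X + _]big_nat_cond [X in _ = X + _]big1 ?add0r // => p /andP[/andP[_ pk] _].
  have [k0 p0] : ~~ odd k /\ p = 0%N by case: (odd k) pk; case: p.
  rewrite /F p0 /=; case: eqP => [b0|]; last by rewrite mul0r.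
  have : odd (W_pos i).
    move: (b0); rewrite /b /W_block /W_pos k0 addn1 => /esym.
    by case: (i : nat) => [|[|x]].
  by move=> ->; rewrite b0 th0 // sin0 mul0r.
rewrite sum_pairs big_mkord.
have bN : (b < (k.+1 + ~~ odd k)./2)%N.
  rewrite -ltn_double -W_pos_half (@leq_ltn_trans (W_pos i)) //.
    by rewrite -[leqRHS]odd_double_half leq_addl.
  by rewrite ltn_add2r.
rewrite (bigD1 (Ordinal bN)) //= big1 ?addr0 => [|q qb]; last first.
  rewrite /F /= uphalf_double doubleK; suff /negPf-> : b != q by rewrite !mul0r addr0.
  by apply: contra qb => /eqP bq; apply/eqP/val_inj.
rewrite /F /= uphalf_double doubleK eqxx odd_double rot_blocksE -/b.
case: (b == W_block l); last by rewrite !mulr0 addr0.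
by rewrite sinD cosD; case: (odd (W_pos i)); case: (odd (W_pos l)) => /=; ring.
Qed.

Lemma rot_blocks_scalar (R : realType) k (theta : nat -> R) c :
  (forall q, cos (theta q) = c /\ sin (theta q) = 0) ->
  rot_blocks k theta = c%:M.
Proof.
move=> th; apply/matrixP => i j; rewrite rot_blocksE mxE W_block_slot.
have [-> ->] := th (W_block i); case: eqP => // _.
by case: (odd _); case: (odd _); rewrite ?oppr0.
Qed.

Lemma cos_sin_natpi (R : realType) N :
  cos (N%:R * pi) = (-1) ^+ N :> R /\ sin (N%:R * pi) = 0 :> R.
Proof.
elim: N => [|N [IHc IHs]]; first by rewrite mul0r cos0 sin0.
by rewrite -natr1 mulrDl mul1r cosDpi sinDpi IHc IHs oppr0 exprS mulN1r.
Qed.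

Lemma W_angle0 (R : realType) n k : ~~ odd k -> W_angle R n k 0 = 0.
Proof. by rewrite /W_angle => /negPf ->; rewrite mul0r mul0r. Qed.

Lemma W_sigma_iter (R : realType) n k a (x : 'cV[R]_k.+1) :
  iter a (mulmx (W_sigma R n k)) x =
  ((-1) ^+ a *: rot_blocks k (fun q => a%:R * W_angle R n k q)) *m x.
Proof.
elim: a => [|a IHa].
  rewrite expr0 scale1r (@rot_blocks_scalar _ _ _ 1) ?mul1mx // => q.
  by rewrite mul0r cos0 sin0.
rewrite iterS {}IHa mulmxA /W_sigma mulNmx -scalemxAr rot_blocksM; last exact: W_angle0.
rewrite exprS mulN1r scaleNr; congr (- (_ *: rot_blocks _ _) *m _).
by apply/funext => q; rewrite -natr1 mulrDl mul1r addrC.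
Qed.

Lemma W_sigma_order (R : realType) n k (x : 'cV[R]_k.+1) : (0 < n)%N ->
  iter (2 * n + k) (mulmx (W_sigma R n k)) x = x.
Proof.
move=> n0; rewrite W_sigma_iter (@rot_blocks_scalar _ _ _ ((-1) ^+ (odd k))).
  rewrite scale_scalar_mx -exprD mul_scalar_mx -signr_odd.
  have -> : odd (2 * n + k + odd k) = false by rewrite oddD oddD oddM /= oddb addbb.
  by rewrite scale1r.
move=> q; rewrite /W_angle mulrC mulfVK ?pnatr_eq0; last by lia.
have [-> ->] := cos_sin_natpi R (2 * q + odd k); split=> //.
by rewrite exprD mulnC exprM sqrr_sign mul1r.
Qed.

Lemma W_rho2 (R : realType) k : W_rho R k *m W_rho R k = 1%:M.
Proof.
rewrite mulmx_diag -diag_const_mx; congr diag_mx.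
by apply/rowP => i; rewrite !mxE; case: ifP; rewrite ?mulrNN mulr1.
Qed.

Lemma W_rhoK (R : realType) k (x : 'cV[R]_k.+1) :
  W_rho R k *m (W_rho R k *m x) = x.
Proof. by rewrite mulmxA W_rho2 mul1mx. Qed.

Lemma W_sigma_rho (R : realType) n k (x : 'cV[R]_k.+1) :
  W_rho R k *m (W_sigma R n k *m (W_rho R k *m (W_sigma R n k *m x))) = x.
Proof.
have -> : W_sigma R n k *m (W_rho R k *m (W_sigma R n k *m x)) =
   W_rho R k *m x; last exact: W_rhoK.
have WN : W_rho R k *m (W_sigma R n k *m x) =
  - rot_blocks k (fun q => - W_angle R n k q) *m (W_rho R k *m x).
  rewrite !mulmxA; congr (_ *m _); rewrite /W_sigma mulmxN mulNmx; congr (- _).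
  rewrite mul_diag_mx mul_mx_diag; apply/matrixP => i j.
  rewrite [LHS]mxE [RHS]mxE !rot_blocksE !mxE cosN sinN; case: eqP => [bij|]; last by rewrite mulr0 mul0r.
  have [->|ij] := eqVneq i j.
    by case: (odd (W_pos j)); case: ifP => _; ring.
  have pos0 (l l' : 'I_k.+1) : W_block l = W_block l' -> l != l' ->
      odd (W_pos l) -> (0 < l)%N.
    move=> bll ll' ol; rewrite lt0n; apply: contra ll' => /eqP l0.
    have k0 : ~~ odd k by move: ol; rewrite /W_pos l0; case: (odd k).
    move: bll; rewrite /W_block /W_pos l0 k0 -val_eqE /= l0 addn1.
    by case: (l' : nat) => [|[|p]].
  have oij : odd (W_pos i) != odd (W_pos j).
    by move: ij; rewrite W_block_slot bij eqxx.
  have ji : j != i by rewrite eq_sym.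
  move: oij (pos0 i j bij ij) (pos0 j i (esym bij) ji).
  case: (odd (W_pos i)); case: (odd (W_pos j)) => // _.
    by move=> /(_ isT)-> _; rewrite andbF /=; ring.
  by move=> _ /(_ isT)->; rewrite andbF /=; ring.
rewrite WN mulmxA /W_sigma mulNmx mulmxN opprK rot_blocksM; last exact: W_angle0.
rewrite (@rot_blocks_scalar _ _ _ 1) ?mul1mx // => q.
by rewrite subrr cos0 sin0.
Qed.

Definition W_action (R : realType) n k (n_gt0 : (0 < n)%N) :
    {action dihedral (2 * n + k) &-> 'cV[R]_k.+1} :=
  dih_action (Zm_gt1 k n_gt0) (fun x => W_sigma_order x n_gt0)
    (@W_rhoK R k) (@W_sigma_rho R n k).

(* The norm of the library on matrices is the sup norm, so the Euclidean unit
   sphere is written out. *)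
Definition W_sphere (R : realType) k : set 'cV[R]_k.+1 :=
  [set x : 'cV[R]_k.+1 | \sum_i x i 0 ^+ 2 = 1]%classic.

Definition SW (R : realType) k : topologicalType :=
  classical_sets.set_type (@W_sphere R k).

Lemma W_sphereE (R : realType) k (x : 'cV[R]_k.+1) :
  W_sphere x <-> x^T *m x = 1%:M.
Proof.
have E : (x^T *m x) 0 0 = \sum_i x i 0 ^+ 2.
  by rewrite mxE; apply: eq_bigr => i _; rewrite mxE expr2.
split=> [x1|x1]; last by rewrite /W_sphere /= -E x1 mxE.
by apply/matrixP => i j; rewrite !ord1 E x1 mxE.
Qed.

Lemma W_sphere_orthogonal (R : realType) k (A : 'M[R]_k.+1) x :
  A^T *m A = 1%:M -> W_sphere x -> W_sphere (A *m x).
Proof.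
move=> A1 /W_sphereE x1; apply/W_sphereE.
by rewrite trmx_mul -mulmxA (mulmxA A^T) A1 mul1mx.
Qed.

Lemma W_sigma_orthogonal (R : realType) n k :
  (W_sigma R n k)^T *m W_sigma R n k = 1%:M.
Proof.
have -> : (W_sigma R n k)^T = - rot_blocks k (fun q => - W_angle R n k q).
  apply/matrixP => i j; rewrite [LHS]mxE [LHS]mxE [RHS]mxE !rot_blocksE.
  rewrite cosN sinN opprK eq_sym; case: eqP => // <-.
  by case: (odd (W_pos i)); case: (odd (W_pos j)).
rewrite mulNmx mulmxN opprK rot_blocksM => [|/W_angle0->]; last exact: oppr0.
apply: rot_blocks_scalar => q; by rewrite addNr cos0 sin0.
Qed.

Lemma W_rho_orthogonal (R : realType) k : (W_rho R k)^T *m W_rho R k = 1%:M.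
Proof. by rewrite [X in X *m _]tr_diag_mx W_rho2. Qed.

Lemma SW_fun_mem (R : realType) n k (n_gt0 : (0 < n)%N) (x : SW R k) g :
  W_action R k n_gt0 (\val x) g \in @W_sphere R k.
Proof.
apply/mem_set; case: x => x /= /set_mem; case: g => i e.
move=> Sx; change (W_sphere (iter e (mulmx (W_rho R k))
  (iter i (mulmx (W_sigma R n k)) x))).
have {Sx} : W_sphere (iter i (mulmx (W_sigma R n k)) x).
  elim: (i : nat) => // a; exact/W_sphere_orthogonal/W_sigma_orthogonal.
by case: e => //; apply/W_sphere_orthogonal/W_rho_orthogonal.
Qed.

Definition SW_fun (R : realType) n k (n_gt0 : (0 < n)%N)
    (x : SW R k) (g : dihedral (2 * n + k)) : SW R k :=
  exist (fun y => y \in @W_sphere R k) _ (SW_fun_mem n_gt0 x g).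

Lemma SW_fun_action (R : realType) n k (n_gt0 : (0 < n)%N) :
  is_action [set: dihedral (2 * n + k)] (@SW_fun R n k n_gt0).
Proof.
apply: is_total_action => [x|x g h]; apply: val_inj.
  exact: (total_act1 (W_action R k n_gt0)).
exact: (total_actM (W_action R k n_gt0)).
Qed.

Definition SW_action (R : realType) n k (n_gt0 : (0 < n)%N) :
  {action dihedral (2 * n + k) &-> SW R k} := Action (SW_fun_action R k n_gt0).

Lemma SW_opp_mem (R : realType) k (x : SW R k) : - \val x \in @W_sphere R k.
Proof.
apply/mem_set; case: x => x /= /set_mem; rewrite /W_sphere /= => <-.
by apply: eq_bigr => i _; rewrite mxE sqrrN.
Qed.

Definition SW_opp (R : realType) k (x : SW R k) : SW R k :=
  exist (fun y => y \in @W_sphere R k) _ (SW_opp_mem x).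

(* Main.v *)
(* Each [x] in the sphere is evaluated along the alternating trigonometric
   moment curve [v_j], [j] in Z/m, on which the dihedral group acts as on the
   indices.  The sequence [y_j = <x, v_j>] is (-1)^j times a trigonometric
   polynomial of degree at most k/2, hence orthogonal to those of degree at
   most n - 1; a product of sines with the sign changes of [y] then shows that
   [y] has at least [n] cyclic runs of positive terms, so that some stable set
   lies in [y > 0], and another one in [y < 0].  For every threshold [t] >= 0,
   the stable sets contained in [y > t] and those contained in [y < -t] form,
   as long as both kinds exist, an element of Hom(K_2, SG), decreasing with
   [t].  The barycentric coordinate of [x] at [p] is the normalized length of
   the set of thresholds giving [p], an explicit continuous expression in mins
   and maxs that commutes with all the symmetries. *)
Require Import Defs.
From mathcomp Require Import all_boot all_order all_algebra.
From mathcomp Require Import all_fingroup all_solvable.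
From mathcomp Require Import all_classical all_reals all_analysis.
From mathcomp Require Import ring zify.
From mathcomp Require Import finset.

Set Implicit Arguments.
Unset Strict Implicit.
Unset Printing Implicit Defensive.

Import Order.TTheory GRing.Theory Num.Theory.
Import numFieldNormedType.Exports.

(** * Sums of cosines over equally spaced angles *)

Section Trigonometry.
Local Open Scope ring_scope.
Variable R : realType.
Implicit Types (a b : R) (j m q N : nat).

(** Each term is [2 sin a cos t = sin (t + a) - sin (t - a)], and consecutive [t] differ by
    [2 a]. *)
Lemma sum_cos_telescope m a b :
  2 * sin a * \sum_(j < m) cos (j%:R * (2 * a) + b) =
  sin (m%:R * (2 * a) + b - a) - sin (b - a).
Proof.
elim: m => [|m IHm]; first by rewrite big_ord0 mul0r add0r mulr0 subrr.
rewrite big_ord_recr /= mulrDr {}IHm.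
set z := m%:R * (2 * a) + b.
have -> : m.+1%:R * (2 * a) + b - a = z + a by rewrite /z -(natr1 m); ring.
by rewrite !sinD cosN sinN; ring.
Qed.

Lemma sin_frac_gt0 m q : (0 < q)%N -> (q < m)%N -> 0 < sin (q%:R * pi / m%:R) :> R.
Proof.
move=> q0 qm; have m0 : 0 < m%:R :> R by rewrite ltr0n; lia.
apply: sin_gt0_pi; apply/andP; split; first by apply: divr_gt0 => //; apply: mulr_gt0; rewrite ?ltr0n ?pi_gt0.
by rewrite ltr_pdivrMr // mulrC ltr_pM2l ?pi_gt0 // ltr_nat.
Qed.

Lemma sin_natmul_2pi m b : sin (m%:R * (2 * pi) + b) = sin b.
Proof.
elim: m b => [|m IHm] b; first by rewrite mul0r add0r.
have -> : m.+1%:R * (2 * pi) + b = (m%:R * (2 * pi) + b) + pi *+ 2.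
  by rewrite -(natr1 m) -[pi *+ 2]mulr_natl; ring.
by rewrite sinD2pi.
Qed.

(** The end terms of the telescoped sum differ by [q] full turns, and [sin (q pi / m)] is
    nonzero. *)
Lemma sum_cos_frac m q b : (0 < q)%N -> (q < m)%N ->
  \sum_(j < m) cos (j%:R * (2 * (q%:R * pi / m%:R)) + b) = 0.
Proof.
move=> q0 qm; have := sum_cos_telescope m (q%:R * pi / m%:R) b.
have m0 : m%:R != 0 :> R by rewrite pnatr_eq0; lia.
have -> : m%:R * (2 * (q%:R * pi / m%:R)) + b - q%:R * pi / m%:R =
  q%:R * (2 * pi) + (b - q%:R * pi / m%:R) by field.
rewrite sin_natmul_2pi subrr => /eqP; rewrite !mulf_eq0 pnatr_eq0 /=.
by rewrite gt_eqF ?sin_frac_gt0 //= => /eqP.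
Qed.

(** Each sine factor splits the frequency [N] into [N + 1] and [N - 1]; the three conditions keep
    all final frequencies even and strictly between [0] and [2 m]. *)
Lemma sum_cos_prod_sin m N (s : seq R) b :
  ((size s).+2 <= N)%N -> (N + size s <= 2 * m - 2)%N -> ~~ odd (N + size s) ->
  \sum_(j < m) cos (j%:R * (N%:R * pi / m%:R) + b) *
    \prod_(a <- s) sin (j%:R * pi / m%:R - a) = 0.
Proof.
elim: s N b => [|a s IHs] N b /= lN Nm.
  rewrite addn0 => oN.
  have NE : (N = 2 * N./2)%N by lia.
  rewrite -[RHS](@sum_cos_frac m N./2 b); [|lia|lia].
  apply: eq_bigr => j _; rewrite big_nil mulr1 {1}NE natrM.
  by rewrite !mulrA.
move=> oN.
(* Sines are written as cosines shifted by [pi / 2], so that the induction hypothesis applies. *)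
have E (j : 'I_m) : cos (j%:R * (N%:R * pi / m%:R) + b) *
    \prod_(c <- a :: s) sin (j%:R * pi / m%:R - c) =
  2^-1 * (cos (j%:R * (N.+1%:R * pi / m%:R) + (b - a - pi / 2)) *
    \prod_(c <- s) sin (j%:R * pi / m%:R - c))
  - 2^-1 * (cos (j%:R * (N.-1%:R * pi / m%:R) + (b + a - pi / 2)) *
    \prod_(c <- s) sin (j%:R * pi / m%:R - c)).
  have NE : N = N.-1.+1 by lia.
  rewrite big_cons; set u := j%:R * pi / m%:R; set P := \prod_(c <- s) _.
  have -> : j%:R * (N%:R * pi / m%:R) = N%:R * u by rewrite /u; ring.
  have -> : j%:R * (N.+1%:R * pi / m%:R) + (b - a - pi / 2) =
     (N%:R * u + b) + (u - a) - pi / 2 by rewrite -(natr1 N) /u; ring.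
  have -> : j%:R * (N.-1%:R * pi / m%:R) + (b + a - pi / 2) =
     (N%:R * u + b) - (u - a) - pi / 2.
    by rewrite [in RHS]NE -(natr1 N.-1) /u; ring.
  rewrite ![cos (_ - pi / 2)]cosB cos_pihalf sin_pihalf !mulr0 !mulr1 !add0r.
  set w := u - a; set z := _ + b.
  by rewrite (sinD z w) (sinB z w); field.
rewrite (eq_bigr _ (fun (j : 'I_m) _ => E j)) sumrB -!mulr_sumr !IHs ?mulr0 ?subrr //; lia.
Qed.

(** The product splits into the frequencies [(q + q') / 2] and [(q - q') / 2], integers by parity;
    only the second can be zero, when [q = q']. *)
Lemma sum_cos_cos m q q' b b' : (q' <= q)%N -> (0 < q)%N -> (q < m)%N ->
  ~~ odd (q + q') ->
  \sum_(j < m) cos (j%:R * (q%:R * pi / m%:R) + b) *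
    cos (j%:R * (q'%:R * pi / m%:R) + b') =
  if q == q' then m%:R / 2 * cos (b - b') else 0.
Proof.
move=> qq q0 qm oq.
have E (j : 'I_m) : cos (j%:R * (q%:R * pi / m%:R) + b) *
    cos (j%:R * (q'%:R * pi / m%:R) + b') =
  2^-1 * cos (j%:R * (2 * ((q + q')./2%:R * pi / m%:R)) + (b + b')) +
  2^-1 * cos (j%:R * (2 * ((q - q')./2%:R * pi / m%:R)) + (b - b')).
  have h1 : 2 * ((q + q')./2%:R * pi / m%:R) = q%:R * pi / m%:R + q'%:R * pi / m%:R :> R.
    rewrite !mulrA -mulrDl -mulrDl -natrM -natrD.
    by congr (_%:R * _ / _); lia.
  have h2 : 2 * ((q - q')./2%:R * pi / m%:R) = q%:R * pi / m%:R - q'%:R * pi / m%:R :> R.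
    rewrite !mulrA -mulrBl -mulrBl -natrM -natrB //.
    by congr (_%:R * _ / _); lia.
  set A := j%:R * (q%:R * pi / m%:R) + b.
  set B := j%:R * (q'%:R * pi / m%:R) + b'.
  have -> : j%:R * (2 * ((q + q')./2%:R * pi / m%:R)) + (b + b') = A + B.
    by rewrite h1 /A /B; ring.
  have -> : j%:R * (2 * ((q - q')./2%:R * pi / m%:R)) + (b - b') = A - B.
    by rewrite h2 /A /B; ring.
  by rewrite (cosD A B) (cosB A B); field.
rewrite (eq_bigr _ (fun (j : 'I_m) _ => E j)) big_split /= -!mulr_sumr sum_cos_frac; [|lia|lia].
rewrite mulr0 add0r; case: eqP => [->|qq']; last by rewrite sum_cos_frac ?mulr0 //; lia.
rewrite subnn; under eq_bigr do rewrite /= !mul0r mulr0 mulr0 add0r.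
by rewrite sumr_const card_ord -mulr_natl; ring.
Qed.

Lemma cos_natpi_add m b : cos (m%:R * pi + b) = (-1) ^+ m * cos b :> R.
Proof.
by have [c s] := cos_sin_natpi R m; rewrite cosD c s mul0r subr0.
Qed.

End Trigonometry.

(** * Sign changes of a periodic sequence *)

Section SignChanges.
Local Open Scope ring_scope.
Variable R : realType.

Lemma count_changes (b : nat -> bool) m : b m = b 0%N ->
  count (fun g => b g (+) b g.+1) (iota 0 m) =
  (2 * count (fun g => b g && ~~ b g.+1) (iota 0 m))%N.
Proof.
move=> bm.
(* Without periodicity, rises minus falls is [b m - b 0]; this form goes through the induction. *)
suff E : (count (fun g => b g (+) b g.+1) (iota 0 m) + b 0%N =
  2 * count (fun g => b g && ~~ b g.+1) (iota 0 m) + b m)%N.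
  by apply/eqP; rewrite -(eqn_add2r (b 0%N)) E bm.
elim: m {bm} => [//|m IHm]; rewrite -addn1 iotaD !count_cat add0n /= !addn0 addn1.
by move: IHm; case: (b m); case: (b m.+1); case: (b 0%N); rewrite /=; lia.
Qed.

(** Each change at some [g >= j] contributes [-1], so the product records the parity of the changes
    from [j] to [m]. *)
Lemma prod_change_sign (b : nat -> bool) m j : (j <= m)%N ->
  \prod_(0 <= g < m | b g (+) b g.+1) (if (j <= g)%N then -1 else 1) =
  (-1) ^+ (b j (+) b m) :> R.
Proof.
elim: m => [|m IHm]; first by rewrite leqn0 => /eqP->; rewrite big_geq // addbb.
rewrite leq_eqVlt => /orP[/eqP->|]; last first.
  rewrite ltnS big_mkcond /= big_nat_recr //= -big_mkcond /= => jm.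
  rewrite IHm // jm; case: (b j); case: (b m); case: (b m.+1) => /=;
  by rewrite ?expr0 ?expr1 ?mulr1 ?mul1r ?mulrNN ?mulr1.
rewrite addbb expr0 big_nat_cond big1 // => g /andP[/andP[_ gm] _].
by rewrite leqNgt gm.
Qed.

(** The root [(2 g + 1) pi / (2 m)] lies midway between the grid angles of [g] and [g + 1]: the sine
    changes sign there and vanishes at no grid angle. *)
Lemma sin_grid_sign m j g : (j < m)%N -> (g < m)%N ->
  0 < (if (j <= g)%N then -1 else 1) *
      sin (j%:R * pi / m%:R - (2 * g + 1)%:R * pi / (2 * m)%:R) :> R.
Proof.
move=> jm gm; have m0 : m%:R != 0 :> R by rewrite pnatr_eq0; lia.
have -> : j%:R * pi / m%:R = (2 * j)%:R * pi / (2 * m)%:R :> R.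
  by rewrite !natrM; field.
case: leqP => [jg|gj].
  rewrite mulN1r -sinN opprB -!mulrBl -natrB; last by lia.
  by apply: sin_frac_gt0; lia.
rewrite mul1r -!mulrBl -natrB; last by lia.
by apply: sin_frac_gt0; lia.
Qed.

(* Multiplying by the product of sines that changes sign exactly where [y]
   does makes all the terms of a vanishing sum have the same sign. *)
Lemma few_sign_changes_eq0 (y : nat -> R) m n :
  (forall s : seq R, (size s <= 2 * n - 2)%N -> ~~ odd (size s) ->
     \sum_(j < m) y j * \prod_(a <- s) sin (j%:R * pi / m%:R - a) = 0) ->
  y m = y 0%N ->
  (count (fun g => (0 < y g)%R && ~~ (0 < y g.+1)%R) (iota 0 m) < n)%N ->
  forall j, (j < m)%N -> y j = 0.
Proof.
move=> y_orth ym; set b := fun g => 0 < y g => bn.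
pose ch g := b g (+) b g.+1.
pose s := [seq (2 * g + 1)%:R * pi / (2 * m)%:R : R | g <- iota 0 m & ch g].
have size_s : size s = (2 * count (fun g => b g && ~~ b g.+1) (iota 0 m))%N.
  by rewrite size_map size_filter count_changes // /b ym.
pose h j : R := \prod_(a <- s) sin (j%:R * pi / m%:R - a).
have h_gt0 j : (j < m)%N -> 0 < (-1) ^+ (b j (+) b m) * h j.
  move=> jm; rewrite -prod_change_sign 1?ltnW // /h /s big_map big_filter.
  rewrite -[X in iota 0 X]subn0 -/(index_iota 0 m) -big_split /=.
  rewrite big_nat_cond prodr_gt0 // => g /andP[/andP[_ gm] _].
  exact: sin_grid_sign.
(* Zero counts as not positive, so this inequality is weak; as [h_gt0] is strict, a vanishing sum
   forces [y j = 0]. *)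
have y_sign j : 0 <= - (-1) ^+ (b j) * y j.
  rewrite /b; case: ltP => [/ltW|] y0; rewrite ?expr1 ?expr0 ?opprK ?mul1r //.
  by rewrite mulN1r oppr_ge0.
have term j : (- (-1) ^+ (b j) * y j) * ((-1) ^+ (b j (+) b m) * h j) =
    - (-1) ^+ (b m) * (y j * h j).
  by rewrite signr_addb; case: (b j); rewrite ?expr1 ?expr0; ring.
have sum0 : \sum_(j < m)
    (- (-1) ^+ (b j) * y j) * ((-1) ^+ (b j (+) b m) * h j) = 0.
  under eq_bigr do rewrite term.
  rewrite -mulr_sumr /h y_orth ?mulr0 // size_s; last by rewrite oddM.
  by move: bn; rewrite /b; lia.
move=> j jm; move/psumr_eq0P: sum0 => /(_ _ (Ordinal jm) isT) /= H.
have {H} /eqP := H (fun i _ => mulr_ge0 (y_sign i) (ltW (h_gt0 i (ltn_ord i)))).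
rewrite mulf_eq0 (gt_eqF (h_gt0 j jm)) orbF mulf_eq0 oppr_eq0 signr_eq0 /=.
by move/eqP.
Qed.

End SignChanges.

(** * The alternating moment curve and Gale's lemma *)

Section Vectors.
Local Open Scope ring_scope.
Variables (R : realType) (n k : nat).
Hypothesis n_gt0 : (0 < n)%N.
Local Notation m := (2 * n + k)%N.
Implicit Types (x y : 'cV[R]_k.+1) (i l : 'I_k.+1) (j : nat).

(** These are the coordinates negated by [W_rho]. The test [0 < i] excludes the isolated coordinate
    of even [k], whose position is odd. *)
Definition is_sin i : bool := (0 < i)%N && odd (W_pos i).
(** Frequencies are counted in units of [pi / m]. *)
Definition freq i : nat := 2 * W_block i + odd k.
Definition phase i : R := - (if is_sin i then pi / 2 else 0).

Definition curve_start : 'cV[R]_k.+1 := \col_i (~~ is_sin i)%:R.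

(* The alternating trigonometric moment curve at the [m]-th roots of unity. *)
Definition curve j : 'cV[R]_k.+1 := iter j (mulmx (W_sigma R n k)) curve_start.

Definition dot x y : R := \sum_i x i 0 * y i 0.

Let m_neq0 : m%:R != 0 :> R.
Proof. by rewrite pnatr_eq0; lia. Qed.

Lemma freq_le i : (freq i <= k)%N.
Proof.
rewrite /freq /W_block /W_pos; have := ltn_ord i.
by case: (boolP (odd k)) => ok /=; lia.
Qed.

Lemma curveE j i : curve j i 0 =
  (-1) ^+ j * cos (j%:R * ((freq i)%:R * pi / m%:R) + phase i).
Proof.
rewrite /curve W_sigma_iter -scalemxAl mxE; congr (_ * _).
rewrite mxE; under eq_bigr do rewrite rot_blocksE mxE.
have -> : j%:R * W_angle R n k (W_block i) = j%:R * ((freq i)%:R * pi / m%:R) by [].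
set w := j%:R * _.
have [sin_i|cos_i] := boolP (is_sin i).
  have [i0 oi] := andP sin_i.
  (* The cosine partner of [i]: the only coordinate of its block where the start vector is
     nonzero. *)
  pose l := inord i.-1 : 'I_k.+1.
  have lE : l = i.-1 :> nat by rewrite inordK //; have := ltn_ord i; lia.
  have bl : W_block l = W_block i.
    by move: oi; rewrite /W_block /W_pos lE; lia.
  have ol : odd (W_pos l) = false.
    by move: oi; rewrite /W_pos lE; lia.
  rewrite (bigD1 l) //= big1 ?addr0 => [|l' l'l].
    rewrite /is_sin ol andbF mulr1 bl eqxx oi /phase sin_i.
    by rewrite cosB cos_pihalf sin_pihalf mulr0 mulr1 add0r.
  case: eqP => [bl'|]; last by rewrite mul0r.
  suff -> : is_sin l' by rewrite mulr0.
  have ol' : odd (W_pos l').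
    by apply: contraNT l'l => ol'; rewrite W_block_slot bl -bl' eqxx ol (negPf ol').
  rewrite /is_sin ol' andbT lt0n; apply/eqP => l'0.
  by move: bl' ol' oi i0; rewrite /W_block /W_pos l'0; case: (odd k) => /=; lia.
rewrite (bigD1 i) //= big1 ?addr0 => [|l li].
  by rewrite cos_i mulr1 eqxx /phase (negPf cos_i) oppr0 addr0; case: (odd _).
case: eqP => [bl|]; last by rewrite mul0r.
suff -> : is_sin l by rewrite mulr0.
move: cos_i li; rewrite W_block_slot -bl eqxx /= /is_sin negb_and -leqNgt leqn0.
move: bl; rewrite /W_block /W_pos; have := ltn_ord l.
by case: (boolP (odd k)) => ok /=; rewrite ?addn0 ?addn1 /=; lia.
Qed.

(** Absorbing the sign [(-1)^j] as a phase [j pi] raises the frequency by [m], into the range of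
    [sum_cos_prod_sin]. *)
Lemma curve_cosE j i : curve j i 0 =
  cos (j%:R * ((freq i + m)%:R * pi / m%:R) + phase i).
Proof.
rewrite curveE -cos_natpi_add; congr cos; rewrite (natrD _ (freq i)).
by move: m_neq0; move: (m%:R) => M M_neq0; field.
Qed.

Lemma curve_period j : curve (j + m) = curve j.
Proof. by rewrite /curve iterD W_sigma_order. Qed.

Lemma curve_modn j : curve (j %% m) = curve j.
Proof.
rewrite [in RHS](divn_eq j m) [in RHS](addnC _ (j %% m)%N).
elim: (j %/ m)%N => [|q ->]; first by rewrite mul0n addn0.
by rewrite (mulSn q) (addnC m) addnA curve_period.
Qed.

Lemma curve_Zp_add1 (i : 'Z_m) : curve (i + 1)%R = W_sigma R n k *m curve i.
Proof.
have -> : ((i + 1)%R : nat) = (i.+1 %% m)%N.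
  by rewrite /= modnDmr addn1; congr (_ %% _)%N; exact: (Zp_cast (Zm_gt1 k n_gt0)).
by rewrite curve_modn.
Qed.

(** The frequencies [freq i + m] lie between [m] and [m + k]; as [m = 2 n + k], this leaves room for
    [2 n - 2] sine factors. *)
Lemma dot_prod_sin x (s : seq R) : (size s <= 2 * n - 2)%N -> ~~ odd (size s) ->
  \sum_(j < m) dot x (curve j) * \prod_(a <- s) sin (j%:R * pi / m%:R - a) = 0.
Proof.
move=> size_s odd_s; under eq_bigr do rewrite mulr_suml.
rewrite exchange_big big1 // => i _ /=.
under eq_bigr do rewrite curve_cosE -mulrA.
rewrite -mulr_sumr sum_cos_prod_sin ?mulr0 //; have := freq_le i; [lia|lia|].
by move=> _; rewrite /freq; lia.
Qed.

(** The alternating signs cancel, leaving discrete orthogonality of sines and cosines. Frequency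
    zero occurs only for the constant coordinate of even [k]. *)
Lemma sum_curve_mul i l :
  \sum_(j < m) curve j i 0 * curve j l 0 =
  if i == l then (if freq i == 0%N then m%:R else m%:R / 2) else 0.
Proof.
have curveM : \sum_(j < m) curve j i 0 * curve j l 0 = \sum_(j < m)
   cos (j%:R * ((freq i)%:R * pi / m%:R) + phase i) *
   cos (j%:R * ((freq l)%:R * pi / m%:R) + phase l).
  apply: eq_bigr => j _; rewrite !curveE mulrACA -exprD addnn -signr_odd odd_double.
  by rewrite expr0 mul1r.
have freq_m i' : (freq i' < m)%N by have := freq_le i'; lia.
have even_freq i' l' : ~~ odd (freq i' + freq l') by rewrite /freq; lia.
have freq0 i' : freq i' = 0%N -> i' = 0 :> nat /\ phase i' = 0.
  rewrite /freq /W_block /phase /is_sin /W_pos => f0.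
  have i0 : (i' : nat) = 0%N by case: (odd k) f0 => /=; lia.
  by split=> //; rewrite i0 /= oppr0.
have cosp : cos (phase i - phase l) = (is_sin i == is_sin l)%:R.
  rewrite /phase; case: (is_sin i); case: (is_sin l);
  by rewrite /= !(oppr0, subr0, opprK, add0r, addr0, subrr, addNr, cosN, cos_pihalf, cos0).
have eqE : (i == l) = (freq i == freq l) && (is_sin i == is_sin l).
  rewrite W_block_slot /freq eqn_add2r eqn_pmul2l //.
  have [bil|//] := eqVneq (W_block i) (W_block l); rewrite /= /is_sin.
  by move: bil; rewrite /W_block /W_pos; case: (odd k) => /=; lia.
rewrite curveM eqE.
have [f0|] := eqVneq (freq i) 0%N.
  have [i0 pi0] := freq0 _ f0.
  have [fl|] := eqVneq (freq l) 0%N; last first.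
    rewrite -lt0n => fl; under eq_bigr do rewrite mulrC.
    rewrite sum_cos_cos //; last by rewrite f0.
    by rewrite f0 gtn_eqF // ltn_eqF.
  have [l0 pl0] := freq0 _ fl.
  rewrite f0 fl eqxx /is_sin i0 l0 /=.
  under eq_bigr do rewrite pi0 pl0 !mul0r mulr0 addr0 cos0 mulr1.
  by rewrite sumr_const card_ord.
rewrite -lt0n => f0.
have [lf|fl] := leqP (freq l) (freq i).
  rewrite sum_cos_cos // cosp; case: (_ == _) => //=.
  by case: (_ == _); rewrite ?mulr1 ?mulr0.
under eq_bigr do rewrite mulrC.
rewrite sum_cos_cos //; [|exact: ltnW|exact: ltn_trans fl].
by rewrite (gtn_eqF fl) (ltn_eqF fl).
Qed.

(** By orthogonality, pairing the values with coordinate [l] of the curve gives [x l 0] times a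
    nonzero constant. *)
Lemma dot_curve_eq0 x : (forall j, (j < m)%N -> dot x (curve j) = 0) -> x = 0.
Proof.
move=> x0; apply/matrixP => l c; rewrite ord1 [RHS]mxE {c}.
have : \sum_(j < m) dot x (curve j) * curve j l 0 = 0.
  by rewrite big1 // => j _; rewrite x0 ?mul0r.
under eq_bigr do rewrite mulr_suml.
rewrite exchange_big /= (bigD1 l) //= [X in _ + X]big1 ?addr0 => [|i il].
  under eq_bigr do rewrite -mulrA.
  rewrite -mulr_sumr sum_curve_mul eqxx => /eqP; rewrite mulf_eq0.
  case/orP=> [/eqP //|]; case: ifP => _; first by rewrite (negPf m_neq0).
  by rewrite mulf_eq0 (negPf m_neq0) invr_eq0 pnatr_eq0.
under eq_bigr do rewrite -mulrA.
by rewrite -mulr_sumr sum_curve_mul (negPf il) mulr0.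
Qed.

(* Gale's lemma: the indices of the positive coordinates followed by a
   non-positive one form a stable set. *)
Lemma stable_positive x : x != 0 ->
  exists S : SG n k, forall i : 'Z_m, i \in (S : {set _}) -> 0 < dot x (curve i).
Proof.
move=> x_neq0; pose y j := dot x (curve j).
pose D := [set i : 'Z_m | (0 < y i) && ~~ (0 < y (i + 1)%R)].
have m1 := Zm_gt1 k n_gt0.
have cardD : #|D| = count (fun g => (0 < y g) && ~~ (0 < y g.+1)) (iota 0 m).
  rewrite -[X in iota 0 X](Zp_cast m1) -sum1_card -sum1_count.
  rewrite -[X in iota 0 X]subn0 -/(index_iota 0 _) big_mkord.
  apply: eq_bigl => i; rewrite inE; congr (_ && ~~ (0 < _)).
  by rewrite /y curve_Zp_add1.
(* Fewer than [n] falls would make [y] vanish identically, whence [x = 0]. *)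
have : (n <= #|D|)%N.
  rewrite leqNgt; apply: contra x_neq0; rewrite cardD => Dn; apply/eqP.
  apply: dot_curve_eq0; apply: few_sign_changes_eq0 Dn; first exact: dot_prod_sin.
  by rewrite /y -[m]add0n curve_period.
move=> /card_geqP[s [s_uniq s_size sD]].
have sP : @Defs.stable n k [set i in s].
  rewrite /Defs.stable cardsE (card_uniqP s_uniq) s_size eqxx /=.
  apply/forallP => i; rewrite !inE; apply/negP => /andP[/sD + /sD].
  by rewrite !inE => /andP[_ /negPf->].
by exists (SGVertex sP) => i; rewrite inE => /sD; rewrite inE => /andP[].
Qed.

End Vectors.

(** * From two functions on vertices to a point of the realization *)

Section ThresholdMap.
Local Open Scope ring_scope.
Variable R : realType.

Section Weight.
Variable H : graph.
Implicit Types (a b : H -> R) (p q : HomPoset K2 H) (A : {set H}).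

(** For [t] in [0, 1[, [A] is the superlevel set [a > t] exactly when [lower a A <= t < upper a A];
    the defaults [1] and [0] confine [t] to that interval. *)
Definition upper a A : R := \big[Num.min/1]_(S in A) a S.
Definition lower a A : R := \big[Num.max/0]_(S | S \notin A) a S.

(* The length of the set of thresholds [t] in [0, 1[ such that [p] is the pair
   of the superlevel sets [a > t] and [b > t]. *)
Definition weight a b p : R :=
  Num.max 0 (Num.min (upper a (p false)) (upper b (p true)) -
             Num.max (lower a (p false)) (lower b (p true))).

Definition coord a b p : R := weight a b p / \sum_q weight a b q.

Lemma weight_ge0 a b p : 0 <= weight a b p.
Proof. by rewrite le_max lexx. Qed.

Definition at_threshold a b p (t : R) : Prop :=
  (forall S, (S \in p false) = (t < a S)) /\
  (forall S, (S \in p true) = (t < b S)).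

Lemma superlevel_bounds a A t :
  t < upper a A -> lower a A <= t -> forall S, (S \in A) = (t < a S).
Proof.
move=> /bigmin_gtP[_ up] /bigmax_leP[_ lo] S.
by case: (boolP (S \in A)) => SA; [rewrite up|rewrite ltNge lo].
Qed.

Lemma weight_threshold a b p : weight a b p != 0 -> exists t, at_threshold a b p t.
Proof.
rewrite /weight; case: ltP; rewrite ?eqxx // subr_gt0 => + _.
rewrite lt_min => /andP[ta tb].
(* The interval of thresholds contains its left end, the witness chosen here. *)
set t := Num.max _ _ in ta tb.
by exists t; split; apply: superlevel_bounds; rewrite // /t le_max lexx ?orbT.
Qed.

Lemma at_threshold_le a b p q t s : at_threshold a b p t ->
  at_threshold a b q s -> s <= t -> (p <= q)%O.
Proof.
move=> [pa pb] [qa qb] st; rewrite le_HomE; apply/forallP => -[].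
- by apply/fintype.subsetP => S; rewrite pb qb; apply: le_lt_trans.
- by apply/fintype.subsetP => S; rewrite pa qa; apply: le_lt_trans.
Qed.

(** Thresholds are totally ordered and superlevel sets shrink as they grow, so the support is a
    chain. *)
Lemma weight_chain a b p q : weight a b p != 0 -> weight a b q != 0 -> (p >=< q)%O.
Proof.
move=> /weight_threshold[t pt] /weight_threshold[s qs].
by apply/orP; case: (leP s t) => [|/ltW] st; [left|right]; apply: at_threshold_le st; eassumption.
Qed.

(** Values are positive on the sets and at most [0] off them, so the interval of thresholds starts
    at [0] and has positive length. *)
Lemma at_threshold0_weight a b p : at_threshold a b p 0 -> 0 < weight a b p.
Proof.
move=> [pa pb]; rewrite lt_max ltxx /= subr_gt0.
have pos c A : (forall S, (S \in A) = (0 < c S)) ->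
    lower c A = 0 /\ 0 < upper c A.
  move=> cA; split.
    by apply: bigmax_eq_id => S; rewrite cA -leNgt.
  by apply/bigmin_gtP; split=> // S; rewrite cA.
have [-> ua] := pos _ _ pa; have [-> ub] := pos _ _ pb.
by rewrite maxxx lt_min ua.
Qed.

(** The two positivity sets form a multihomomorphism, whose weight is positive. *)
Lemma sum_weight_gt0 a b :
  (forall S T, 0 < a S -> 0 < b T -> @adj H S T) ->
  (exists S, 0 < a S) -> (exists T, 0 < b T) -> 0 < \sum_p weight a b p.
Proof.
move=> ab [S0 aS0] [T0 bT0].
pose f := [ffun u : K2 => if u then [set T | 0 < b T]%SET else [set S | 0 < a S]%SET].
have fP : is_multihom f.
  apply/andP; split.
    apply/forallP => u; rewrite ffunE; apply/set0Pn.
    by case: u; [exists T0|exists S0]; rewrite inE.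
  apply/forallP => u; apply/forallP => v; apply/implyP => uv.
  apply/forall_inP => S Su; apply/forall_inP => T Tv; move: uv Su Tv.
  rewrite !ffunE; case: u; case: v => //= _; rewrite !inE => ? ?.
    by rewrite adj_sym ab.
  by rewrite ab.
have f0 : at_threshold a b (MultiHom fP) 0.
  by split=> S /=; rewrite ffunE inE.
rewrite (bigD1 (MultiHom fP)) //= ltr_pwDl ?sumr_ge0 //.
  exact: at_threshold0_weight.
by move=> p _; apply: weight_ge0.
Qed.

Lemma coord_mem a b : 0 < \sum_p weight a b p ->
  coord a b \in geom_realization R (order_complex (HomPoset K2 H)).
Proof.
move=> s0; have wE p : (coord a b p != 0) = (weight a b p != 0).
  by rewrite mulf_eq0 invr_eq0 (gt_eqF s0) orbF.
have c1 : \sum_p coord a b p = 1.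
  by rewrite -mulr_suml divff // gt_eqF.
apply/mem_set; split=> //.
- by move=> p; rewrite divr_ge0 ?weight_ge0 // ltW.
- rewrite inE; apply/andP; split.
    apply/set0Pn; apply/existsP; apply: contraPT c1 => /existsPn c0.
    rewrite big1 => [/esym/eqP|p _]; first by rewrite oner_eq0.
    by have := c0 p; rewrite inE negbK => /eqP.
  apply/forall_inP => p; rewrite inE wE => p0.
  apply/forall_inP => q; rewrite inE wE => q0; exact: weight_chain q0.
Qed.

Lemma weight_swap a b p :
  weight b a (Hom_pre K2_swap_adj p) = weight a b p.
Proof.
by rewrite /weight /= !ffunE /= minC [X in _ - X]maxC.
Qed.

Lemma coord_swap a b : coord b a = push_coord (Hom_pre K2_swap_adj) (coord a b).
Proof.
have swapK : involutive (@Hom_pre _ _ H _ K2_swap_adj).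
  by move=> p; apply: multihom_eq => -[]; rewrite /= !ffunE.
apply/funext => p; rewrite /push_coord.
rewrite (big_pred1 (Hom_pre K2_swap_adj p)) => [|q]; last first.
  by rewrite /= -(inj_eq (can_inj swapK)) swapK.
rewrite /coord weight_swap; congr (_ / _).
by rewrite [RHS](reindex_inj (can_inj swapK)); apply: eq_bigr => q _; rewrite weight_swap.
Qed.

Section Transport.
Variables (psi : H -> H) (psi_adj : graph_hom psi) (psi_inj : injective psi).

Lemma upper_imset a a' A : (forall S, a' (psi S) = a S) ->
  upper a' (psi @: A) = upper a A.
Proof.
move=> aE; rewrite /upper (reindex_inj psi_inj).
by apply: eq_big => [S|S _]; rewrite ?mem_imset.
Qed.

Lemma lower_imset a a' A : (forall S, a' (psi S) = a S) ->
  lower a' (psi @: A) = lower a A.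
Proof.
move=> aE; rewrite /lower (reindex_inj psi_inj).
by apply: eq_big => [S|S _]; rewrite ?mem_imset.
Qed.

Variables a a' b b' : H -> R.
Hypotheses (aE : forall S, a' (psi S) = a S) (bE : forall S, b' (psi S) = b S).

Lemma weight_post p : weight a' b' (Hom_post psi_adj p) = weight a b p.
Proof.
by rewrite /weight /= !ffunE !(upper_imset _ aE, upper_imset _ bE,
  lower_imset _ aE, lower_imset _ bE).
Qed.

(** An injective self-map of a finite poset is bijective, so the push-forward is a mere relabelling,
    which preserves weights and their sum. *)
Lemma coord_post : coord a' b' = push_coord (Hom_post psi_adj) (coord a b).
Proof.
have post_inj : injective (@Hom_post K2 _ _ _ psi_adj).
  move=> p q pq; apply: multihom_eq => u.
  by have := congr1 (fun r : HomPoset K2 H => r u) pq; rewrite /= !ffunE => /(imset_inj psi_inj).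
have [g gK Kg] := injF_bij post_inj.
apply/funext => p; rewrite /push_coord (big_pred1 (g p)) => [|q]; last first.
  by rewrite /= -(inj_eq (can_inj Kg)) gK.
rewrite /coord -{1}(Kg p) weight_post; congr (_ / _).
by rewrite (reindex_inj post_inj); apply: eq_bigr => q _; rewrite weight_post.
Qed.

End Transport.
End Weight.

Section Continuity.
Variables (X : topologicalType) (H : graph) (a b : X -> H -> R).
Hypotheses (a_cont : forall S, continuous (a^~ S : X -> R))
           (b_cont : forall S, continuous (b^~ S : X -> R)).
Hypothesis sum_gt0 : forall x, 0 < \sum_p weight (a x) (b x) p.

Lemma upper_continuous (c : X -> H -> R) A :
  (forall S, continuous (c^~ S : X -> R)) -> continuous (fun x => upper (c x) A : R).
Proof.
move=> c_cont; apply: continuous_big => // -[x y].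
exact: min_continuous.
Qed.

Lemma lower_continuous (c : X -> H -> R) A :
  (forall S, continuous (c^~ S : X -> R)) -> continuous (fun x => lower (c x) A : R).
Proof.
move=> c_cont; apply: continuous_big => // -[x y].
exact: max_continuous.
Qed.

Lemma weight_continuous p : continuous (fun x => weight (a x) (b x) p : R).
Proof.
move=> x; apply: (@continuous_max R X (cst 0)); first exact: cst_continuous.
apply: continuousB.
  by apply: (@continuous_min R X (fun x => upper (a x) _)); apply: upper_continuous.
by apply: (@continuous_max R X (fun x => lower (a x) _)); apply: lower_continuous.
Qed.

Lemma coord_continuous_at p : continuous (fun x => coord (a x) (b x) p : R).
Proof.
move=> x; apply: (@continuousM R X (fun x => weight (a x) (b x) p)
  (fun x => (\sum_q weight (a x) (b x) q)^-1)); first exact: weight_continuous.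
apply: (@continuousV R X (fun x => \sum_q weight (a x) (b x) q)); first by rewrite gt_eqF.
apply: (@continuous_big R _ +%R 0 xpredT) => [|q _]; last exact: weight_continuous.
exact: add_continuous.
Qed.

Definition threshold_map (x : X) : realization R (HomPoset K2 H) :=
  exist (fun t => t \in geom_realization R (order_complex (HomPoset K2 H)))
    (coord (a x) (b x)) (coord_mem (sum_gt0 x)).

(** The realization has the topology induced by the product, so continuity is checked
    coordinatewise. *)
Lemma threshold_map_continuous : continuous threshold_map.
Proof.
apply: continuous_comp_initial => x.
apply/cvg_sup => p.
move=> U [_ [[W oW <-] Wx]] /= /filterS; apply.
by apply: coord_continuous_at; apply: open_nbhs_nbhs.
Qed.

End Continuity.
End ThresholdMap.

(** * The map on the sphere and its symmetries *)

Section Equivariance.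
Local Open Scope ring_scope.
Variables (R : realType) (n k : nat).
Hypothesis n_gt0 : (0 < n)%N.
Local Notation m := (2 * n + k)%N.
Local Notation curve := (@curve R n k).
Implicit Types (x y : 'cV[R]_k.+1) (S : SG n k).

Lemma dot_mulmx (A : 'M[R]_k.+1) x y : A^T *m A = 1%:M ->
  dot (A *m x) (A *m y) = dot x y.
Proof.
move=> A1; have dotE u v : dot u v = (u^T *m v) 0 0.
  by rewrite mxE; apply: eq_bigr => i _; rewrite mxE.
by rewrite !dotE trmx_mul -mulmxA (mulmxA A^T) A1 mul1mx.
Qed.

Lemma dotNl x y : dot (- x) y = - dot x y.
Proof. by rewrite /dot -sumrN; apply: eq_bigr => i _; rewrite mxE mulNr. Qed.

Lemma W_rho_curve_start : W_rho R k *m curve_start R k = curve_start R k.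
Proof.
rewrite mul_diag_mx; apply/matrixP => i c; rewrite !mxE.
by rewrite -/(is_sin i); case: (is_sin i); rewrite ?mulr0 ?mul1r.
Qed.

(** An inverse-free form of [rho sigma^j = sigma^(-j) rho], applied to the start vector, which [rho]
    fixes. *)
Lemma W_sigma_rho_curve j :
  iter j (mulmx (W_sigma R n k)) (W_rho R k *m curve j) = curve_start R k.
Proof.
elim: j => [|j IHj]; first exact: W_rho_curve_start.
rewrite iterSr -[RHS]IHj; congr (iter _ _ _).
by rewrite -[LHS]W_rhoK W_sigma_rho.
Qed.

Lemma curve_Zp_opp (i : 'Z_m) : curve (- i)%R = W_rho R k *m curve i.
Proof.
have m1 := Zm_gt1 k n_gt0.
have i_lt : (i < m)%N by rewrite -[X in (_ < X)%N](Zp_cast m1).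
have -> : ((- i)%R : nat) = ((m - i) %% m)%N.
  transitivity (((Zp_trunc m).+2 - i) %% (Zp_trunc m).+2)%N; first by [].
  by congr ((_ - _) %% _)%N; exact: (Zp_cast m1).
rewrite curve_modn //.
transitivity (iter (m - i) (mulmx (W_sigma R n k))
  (iter i (mulmx (W_sigma R n k)) (W_rho R k *m curve i))).
  by rewrite W_sigma_rho_curve.
by rewrite -iterD subnK 1?ltnW // W_sigma_order.
Qed.

(** For [t < 1], [t < low x S] means that [S] lies in the set of indices where the value exceeds
    [t]; the cap [1] matches that of [upper]. *)
Definition low x S : R := \big[Num.min/1]_(i in (S : {set _})) dot x (curve i).

Lemma low_gt0P x S :
  reflect (forall i, i \in (S : {set _}) -> 0 < dot x (curve i)) (0 < low x S).
Proof.
by apply: (iffP (bigmin_gtP _ _ _ _)) => [[]|dot_gt0].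
Qed.

(** No index has a positive value for both [x] and [- x]. *)
Lemma low_opp_adj x S T : 0 < low x S -> 0 < low (- x) T -> @adj (SG n k) S T.
Proof.
move=> /low_gt0P xS /low_gt0P xT; rewrite -[adj S T]/[disjoint (S : {set _}) & (T : {set _})].
rewrite disjoint_subset; apply/fintype.subsetP => i iS; rewrite inE; apply/negP => iT.
by have := xT i iT; rewrite dotNl oppr_gt0 => /(lt_trans (xS i iS)); rewrite ltxx.
Qed.

(** [W_sigma] is orthogonal and carries [curve i] to [curve (i + 1)]. *)
Lemma low_rotate x S : low (W_sigma R n k *m x) (SG_rotate S) = low x S.
Proof.
rewrite /low (reindex_inj (@addIr _ 1)); apply: eq_big => [i|i _].
  by rewrite /= (mem_imset _ _ (@addIr _ 1)).
by rewrite (curve_Zp_add1 R n_gt0) dot_mulmx // W_sigma_orthogonal.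
Qed.

Lemma low_reflect x S : low (W_rho R k *m x) (SG_reflect S) = low x S.
Proof.
rewrite /low (reindex_inj oppr_inj); apply: eq_big => [i|i _].
  by rewrite /= (mem_imset _ _ oppr_inj).
by rewrite curve_Zp_opp dot_mulmx // W_rho_orthogonal.
Qed.

(** Reduces equivariance to the two generators. *)
Lemma dih_ind (P : dihedral m -> Prop) :
  P 1%g -> P (dih_sigma m) -> P (dih_rho m) ->
  (forall g h, P g -> P h -> P (g * h)%g) -> forall g, P g.
Proof.
move=> P1 Ps Pr PM g; have PX h j : P h -> P (h ^+ j)%g.
  by move=> Ph; elim: j => [//|j IHj]; rewrite expgS; apply: PM.
by rewrite [g]dihE; apply: PM; apply: PX.
Qed.

Lemma W_actionN x g : W_action R k n_gt0 (- x) g = - W_action R k n_gt0 x g.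
Proof.
elim/dih_ind: g x => [x|x|x|g h IHg IHh x].
- by rewrite !total_act1.
- exact: mulmxN.
- exact: mulmxN.
- by rewrite !total_actM IHg IHh.
Qed.

Lemma low_action x S g :
  low (W_action R k n_gt0 x g) (SG_action k n_gt0 S g) = low x S.
Proof.
elim/dih_ind: g x S => [x S|x S|x S|g h IHg IHh x S].
- by rewrite !total_act1.
- exact: low_rotate.
- exact: low_reflect.
- by rewrite !total_actM IHh IHg.
Qed.

Lemma low_continuous (X : topologicalType) (h : X -> 'cV[R]_k.+1) S :
  continuous h -> continuous (fun z => low (h z) S : R).
Proof.
move=> h_cont; apply: continuous_big => [[u v]|i _]; first exact: min_continuous.
apply: continuous_big => [[u v]|l _]; first exact: add_continuous.
move=> x; apply: continuousM; last exact: cst_continuous.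
apply: (@continuous_comp _ _ _ h (fun y => y l 0)); first exact: h_cont.
exact: coord_continuous.
Qed.

Lemma SW_val_continuous : continuous (fun z : SW R k => \val z).
Proof. exact: initial_continuous. Qed.

Lemma W_sphere_neq0 (x : SW R k) : \val x != 0.
Proof.
case: x => x /= /set_mem Sx; apply: contra_eq_neq Sx => ->.
by rewrite big1 ?(eq_sym 0) ?oner_neq0 // => i _; rewrite mxE expr0n.
Qed.

Lemma low_neq0_exists x : x != 0 -> exists S, 0 < low x S.
Proof.
by move=> /(stable_positive n_gt0)[S SP]; exists S; apply/low_gt0P.
Qed.

Lemma sum_weight_low_gt0 (x : SW R k) :
  0 < \sum_p weight (low (\val x) : SG n k -> R) (low (- \val x)) p.
Proof.
apply: sum_weight_gt0; first exact: low_opp_adj.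
  exact/low_neq0_exists/W_sphere_neq0.
by apply: low_neq0_exists; rewrite oppr_eq0 W_sphere_neq0.
Qed.

Definition sphere_map : SW R k -> realization R (HomPoset K2 (SG n k)) :=
  threshold_map sum_weight_low_gt0.

Lemma sphere_map_continuous : continuous sphere_map.
Proof.
apply: threshold_map_continuous => S; apply: low_continuous.
  exact: SW_val_continuous.
by move=> x; apply: continuousN; apply: SW_val_continuous.
Qed.

Lemma sphere_map_opp (x : SW R k) : sphere_map (SW_opp x) = RHom_tau (sphere_map x).
Proof.
(* Passing to [- x] exchanges the two functions, since [- - x = x]. *)
by apply: val_inj; rewrite /= -coord_swap opprK.
Qed.

(** Both functions are transported by [g]; for that of [- x], the linear action commutes with
    negation. *)
Lemma sphere_map_action (x : SW R k) g :
  sphere_map (SW_action R k n_gt0 x g) = RHom_SG_action R k n_gt0 (sphere_map x) g.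
Proof.
apply: val_inj; apply: coord_post => [|S|S]; first exact: act_inj.
  exact: low_action.
by rewrite -W_actionN low_action.
Qed.

End Equivariance.

Theorem theorem4p3 (R : realType) (n k : nat) (n_gt0 : (0 < n)%N) :
  exists f : SW R k -> realization R (HomPoset K2 (SG n k)),
    [/\ continuous f,
        forall x : SW R k, f (SW_opp x) = RHom_tau (f x) &
        forall (x : SW R k) (g : dihedral (2 * n + k)),
          f (SW_action R k n_gt0 x g) = RHom_SG_action R k n_gt0 (f x) g].
Proof.
exists (@sphere_map R n k n_gt0); split.
- exact: sphere_map_continuous.
- exact: sphere_map_opp.
- exact: sphere_map_action.
Qed.
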